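(* Let $n>1$ be an integer, and $F$ a field. Let $S_t$ be a $t$-dimensional subspace of $\mathrm{PG}(2n-1,F)$ intersecting each $S^I\in\mathcal{S}_{n-1,1,F}^I$ in precisely one point. Define $\Phi=S_t\cap\mathcal{S}_{n-1,1,F}$, and assume $\langle\Phi\rangle=S_t$. Then $|F|\geq t$ and the following properties hold. (i) The set $\Phi$ is a normal rational curve of order $t$. (ii) Let $\Xi^I\in\mathcal{S}_{n-1,1,F}^I$. Then the set $S(\Phi,\Xi^I)$ of the intersections of $\Xi^I$ with all transversal lines $l^{II}\in\mathcal{S}_{n-1,1,F}^{II}$ such that $l^{II}\cap\Phi\neq\emptyset$ is a normal rational curve of order $t$ or $t-1$ if $|F|=t$, and of order $t-1$ if $|F|>t$. (iii) If $\Phi$ is contained in a subvariety $\mathcal{S}_{t-1,1,F}$ of $\mathcal{S}_{n-1,1,F}$, then homogeneous coordinates can be chosen such that $\Phi$ is represented parametrically by $$\left\langle\begin{pmatrix} y_0^t& y_0^{t-1}y_1 &\ldots &y_0y_1^{t-1}\\ y_0^{t-1}y_1&y_0^{t-2}y_1^2&\ldots &y_1^t\end{pmatrix}\right\rangle,\quad (y_0,y_1)\in F^2\setminus\{(0,0)\},$$ and, for every $\Xi^I\in\mathcal{S}_{n-1,1,F}^I$, the set $S(\Phi,\Xi^I)$ is represented, for $z_0$, $z_1$ depending only on $\Xi^I$, by $$\left\langle\begin{pmatrix} y_0^{t-1}z_0& y_0^{t-2}y_1z_0 &\ldots &y_1^{t-1}z_0\\ y_0^{t-1}z_1&y_0^{t-2}y_1z_1&\ldots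 &y_1^{t-1}z_1\end{pmatrix}\right\rangle,\quad (y_0,y_1)\in F^2\setminus\{(0,0)\}.$$
   Context: $\mathrm{PG}(d,F)$ is the $d$-dimensional projective space over the field $F$; dimensions of subspaces are projective; $\langle X\rangle$ is the subspace spanned by $X$. The Segre variety $\mathcal{S}_{a,b,F}$ in $\mathrm{PG}((a+1)(b+1)-1,F)$ is the image of the Segre embedding of $\mathrm{PG}(a,F)\times\mathrm{PG}(b,F)$. Its points may be represented as the one-dimensional spaces spanned by rank one $(b+1)\times(a+1)$ matrices over $F$. It contains two families of maximal subspaces: $\mathcal{S}_{a,b,F}^I$, consisting of the $a$-dimensional subspaces that are the images of $\mathrm{PG}(a,F)\times\{y\}$, and $\mathcal{S}_{a,b,F}^{II}$, consisting of the $b$-dimensional subspaces that are the images of $\{x\}\times\mathrm{PG}(b,F)$. In particular $\mathcal{S}_{n-1,1,F}\subset\mathrm{PG}(2n-1,F)$; $\mathcal{S}_{n-1,1,F}^I$ is a regulus of $(n-1)$-dimensional subspaces, and $\mathcal{S}_{n-1,1,F}^{II}$ consists of its transversal lines. A subvariety $\mathcal{S}_{t-1,1,F}$ of $\mathcal{S}_{n-1,1,F}$ is the image of $U\times\mathrm{PG}(1,F)$ for some $(t-1)$-dimensional subspace $U$ of $\mathrm{PG}(n-1,F)$; its points are represented by rank one $2\times t$ matrices. A normal rational curve of order $t$ is a set of points that spans a $t$-dimensional subspace and, in suitable homogeneous coordinates of that subspace, equals $\{\langle(y_0^t,y_0^{t-1}y_1,\ldots,y_0y_1^{t-1},y_1^t)\rangle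 : (y_0,y_1)\in F^2\setminus\{(0,0)\}\}$ (order $0$: a point; order $1$: a line; if $|F|=t$, it is a set of $t+1$ independent points). *)

(* Defs.v *)
From mathcomp Require Import all_boot all_order all_algebra.
From mathcomp Require Import boolp classical_sets functions cardinality.

Set Implicit Arguments.
Unset Strict Implicit.
Unset Printing Implicit Defensive.

Import GRing.Theory.
Local Open Scope classical_set_scope.
Local Open Scope ring_scope.

(* Projective geometry is done in a vector space [V]: a subspace of projective
   dimension [d] is a [{vspace V}] of dimension [d.+1], a point is a [{vspace V}]
   of dimension 1, and a set of points is a [set {vspace V}]. *)
Section ProjectiveGeometry.
Variables (F : fieldType) (V : vectType F).

Definition pts (W : {vspace V}) : set {vspace V} :=
  [set p | \dim p = 1%N /\ (p <= W)%VS].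

(* [<X> = W] for a set of points [X]: [W] is the least subspace containing [X]. *)
Definition spans (X : set {vspace V}) (W : {vspace V}) : Prop :=
  forall U : {vspace V}, X `<=` pts U <-> (W <= U)%VS.

(* The set of points represented parametrically by [<v y>]. *)
Definition parametrized (v : F * F -> V) : set {vspace V} :=
  [set <[v y]>%VS | y in [set y : F * F | y != (0, 0)]].

(* Homogeneous coordinates of a subspace are coordinates in a basis [e] of it. *)
Definition moment_curve t (e : t.+1.-tuple V) : set {vspace V} :=
  parametrized (fun y =>
    \sum_(i < t.+1) (y.1 ^+ (t - i) * y.2 ^+ i) *: e`_i).

Definition normal_rational_curve t (X : set {vspace V}) : Prop :=
  exists (W : {vspace V}) (e : t.+1.-tuple V),
    [/\ spans X W, basis_of W e & X = moment_curve e].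

End ProjectiveGeometry.

(* Here [m] and [n] are vector space dimensions: [segre F m n] is the Segre
   variety S_{n-1,m-1,F}, and the image of the pair [(<x>, <y>)] under the Segre
   embedding is spanned by the rank one matrix [y *m x]. *)
Section Segre.
Variables (F : fieldType) (m n : nat).

(* The image of [U x PG(m-1,F)]. *)
Definition segre_sub (U : {vspace 'rV[F]_n}) : set {vspace 'M[F]_(m, n)} :=
  [set p | exists (x : 'rV[F]_n) (y : 'cV[F]_m),
     [/\ x \in U, x != 0, y != 0 & p = <[y *m x]>%VS]].

Definition segre : set {vspace 'M[F]_(m, n)} := segre_sub fullv.

(* The images of [PG(n-1,F) x {<y>}]. *)
Definition segreI : set {vspace 'M[F]_(m, n)} :=
  [set limg (linfun (mulmx y : 'rV[F]_n -> 'M[F]_(m, n)))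
     | y in [set y : 'cV[F]_m | y != 0]].

(* The images of [{<x>} x PG(m-1,F)]. *)
Definition segreII : set {vspace 'M[F]_(m, n)} :=
  [set limg (linfun (mulmxr x : 'cV[F]_m -> 'M[F]_(m, n)))
     | x in [set x : 'rV[F]_n | x != 0]].

(* Denoted S(Phi, Xi) mathematically. *)
Definition transversal_section (Phi : set {vspace 'M[F]_(m, n)})
    (Xi : {vspace 'M[F]_(m, n)}) : set {vspace 'M[F]_(m, n)} :=
  \bigcup_(l in [set l | segreII l /\ (pts l `&` Phi) !=set0])
     (pts Xi `&` pts l).

(* The vector with coordinate matrix [A], for coordinates of [U x PG(m-1,F)]
   induced by a basis [e] of [U] and a basis [f] of the space of columns; in such
   coordinates the points of [segre_sub U] are given by rank one matrices. *)
Definition of_coords t (f : m.-tuple 'cV[F]_m) (e : t.-tuple 'rV[F]_n)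
    (A : 'M[F]_(m, t)) : 'M[F]_(m, n) :=
  \sum_(i < m) \sum_(j < t) A i j *: (f`_i *m e`_j).

End Segre.

Arguments segre_sub [F] m [n].
Arguments segre : clear implicits.
Arguments segreI : clear implicits.
Arguments segreII : clear implicits.

(* Main.v *)
Require Import Defs.
From mathcomp Require Import all_boot all_order all_algebra.
From mathcomp Require Import boolp classical_sets functions cardinality.
From mathcomp Require Import ring.

Set Implicit Arguments.
Unset Strict Implicit.
Unset Printing Implicit Defensive.

Import GRing.Theory.
Local Open Scope classical_set_scope.
Local Open Scope card_scope.
Local Open Scope ring_scope.

(** Write a point of the Segre variety as <y x>, with y a column and x a row.
    The hypothesis on [S] says that every direction y carries, up to a factor,
    exactly one row x(y) with y x(y) in [S]. Since Phi spans [S], the space [S]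
    has a basis of vectors P_i = y_i x_i, for 0 <= i <= t
    ([section_frame]). By uniqueness the y_i are pairwise independent
    ([frame_directions]), and t + 1 points on a projective line force |F| >= t.

    A nontrivial linear relation between the rows x_i involves all of them
    ([frame_relation]): were x_k absent, a combination of the other P_i would
    lie in y_k F^n and so be a multiple of P_k. When some direction y differs
    from all y_i, such a relation exists: expand y x(y) in the P_i and apply
    det(., y) to the columns ([missed_direction_dependent]). So either the x_i
    are dependent, or the y_i are all the directions.

    If the x_i are dependent, rescale them so that their sum is 0. The Lagrange
    form, the sum over i of (prod_(j != i) det(y, y_j)) y_i x_i, lies in [S] for
    every y, and the Pluecker identity turns it into y x(y) with x(y) a form of
    degree t - 1 in y ([lagrange_factor]). A form of degree d with d + 1 free
    values has free coefficients, so it parametrizes a normal rational curve of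
    order d ([binary_form_nrc]). This applies to y x(y), of degree t, and to
    z x(y), of degree t - 1, which parametrizes the section of Phi by the
    regulus element of z. The coefficients of x(y) are the basis asked for in
    (iii), where the x_i are dependent because t + 1 vectors lie in a space of
    dimension t.

    If the y_i are all the directions, the Lagrange forms of degree t through
    the P_i, or through the z x_i when the x_i are independent, meet all the
    points that there are. *)

(** * Directions in the projective line *)

Definition det2 (F : fieldType) (a b : F * F) : F := a.1 * b.2 - a.2 * b.1.

Lemma det2_eq0P (F : fieldType) (a b : F * F) : b != (0, 0) -> det2 a b = 0 ->
  exists k, a = (k * b.1, k * b.2).
Proof.
case: a b => a1 a2 [b1 b2]; rewrite /det2 /= xpair_eqE negb_and => b0 ab.
have [b10|b1n] := eqVneq b1 0.
  move: b0 ab; rewrite b10 eqxx /= mulr0 subr0 => b2n /eqP.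
  rewrite mulf_eq0 (negPf b2n) orbF => /eqP->.
  by exists (a2 / b2); rewrite mulr0 divfK.
exists (a1 / b1); rewrite divfK //; congr pair.
by rewrite mulrAC (subr0_eq ab) mulfK.
Qed.

Lemma det2_trans (F : fieldType) (a b c : F * F) : c != (0, 0) ->
  det2 a c = 0 -> det2 b c = 0 -> det2 a b = 0.
Proof.
move=> c0 /(det2_eq0P c0)[k ->] /(det2_eq0P c0)[l ->]; rewrite /det2 /=; ring.
Qed.

Lemma det2C (F : fieldType) (a b : F * F) : det2 a b = - det2 b a.
Proof. by rewrite /det2; ring. Qed.

Lemma det2_self (F : fieldType) (a : F * F) : det2 a a = 0.
Proof. by rewrite /det2 mulrC subrr. Qed.

Lemma det2_exists (F : fieldType) (a : F * F) : a != (0, 0) ->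
  exists2 b, b != (0, 0) & det2 b a != 0.
Proof.
case: a => a1 a2; rewrite xpair_eqE negb_and; case: eqVneq => /= [-> a2n|a1n _].
  by exists (1, 0); rewrite ?xpair_eqE ?oner_eq0 // /det2 /= mul1r mulr0 subr0.
exists (0, 1); first by rewrite xpair_eqE oner_eq0 andbF.
by rewrite /det2 /= mul0r mul1r sub0r oppr_eq0.
Qed.


(** Projecting from the last direction maps the others injectively into the
    affine line. *)
Lemma directions_card_le (F : fieldType) t (Y : 'I_t.+1 -> F * F) :
  (forall i, Y i != (0, 0)) -> (forall i j, i != j -> det2 (Y i) (Y j) != 0) ->
  `I_t #<= [set: F].
Proof.
move=> Y0 hY; have [w w0 hw] := det2_exists (Y0 ord_max).
pose g (i : nat) := det2 (Y (inord i)) w / det2 (Y (inord i)) (Y ord_max).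
suff [f] : $|{injfun `I_t >-> [set: F]}| by exact: inj_card_le f.
apply/injfunPex; exists g => // i j /set_mem/= it /set_mem/= jt eqg.
have neq (k : nat) : (k < t)%N -> det2 (Y (inord k)) (Y ord_max) != 0.
  move=> kt; apply: hY; apply/eqP => /(congr1 val) /=.
  by rewrite inordK 1?ltnW// => kE; rewrite kE ltnn in kt.
have ij : inord i = inord j :> 'I_t.+1.
  apply/eqP/contraT => /hY/eqP[]; apply: (mulIf hw).
  move/eqP: eqg; rewrite /g eqr_div ?neq // => /eqP eqg.
  rewrite mul0r -(subrr (det2 (Y (inord i)) w * det2 (Y (inord j)) (Y ord_max))).
  by rewrite {2}eqg /det2; ring.
by rewrite -(inordK (ltnW it : (i < t.+1)%N)) ij inordK // ltnW.
Qed.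

(** Pigeonhole: the projective line has one point more than [F]. *)
Lemma missed_direction (F : fieldType) t (Y : 'I_t.+1 -> F * F) :
  (forall i, Y i != (0, 0)) -> `I_t.+1 #<= [set: F] ->
  exists2 y, y != (0, 0) & forall i, det2 y (Y i) != 0.
Proof.
move=> Y0 /card_leP/injfunPex[/= g _ ginj].
apply: contrapT => hno.
pose in_I (i : 'I_t.+1) : `I_t.+1 :=
  SigSub (mem_set (ltn_ord i : `I_t.+1 (nat_of_ord i))).
(* the points (1, a) and the point at infinity *)
pose p (o : option 'I_t.+1) : F * F :=
  if o is Some i then (1, val (g (in_I i))) else (0, 1).
have p0 o : p o != (0, 0) by case: o => [i|]; rewrite xpair_eqE oner_eq0 ?andbF.
have pinj o o' : det2 (p o) (p o') = 0 -> o = o'.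
  case: o o' => [i|] [j|] //=; rewrite /det2 /= ?(mul1r, mulr1, mul0r, mulr0).
  - move=> /subr0_eq/val_inj/ginj-/(_ (in_setT _) (in_setT _))/(congr1 val)/= ji.
    by congr Some; apply: val_inj.
  - by rewrite subr0 => /eqP; rewrite oner_eq0.
  - by rewrite sub0r => /eqP; rewrite oppr_eq0 oner_eq0.
have hit o : exists i, det2 (p o) (Y i) == 0.
  apply: contrapT => h; apply: hno; exists (p o) => // i; apply/negP => e.
  by apply: h; exists i.
pose f o := xchoose (hit o).
have finj : injective f.
  move=> o o' ff; apply: pinj; apply: (det2_trans (Y0 (f o))).
    exact/eqP/(xchooseP (hit o)).
  by rewrite ff; exact/eqP/(xchooseP (hit o')).
by have := leq_card f finj; rewrite card_option !card_ord ltnn.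
Qed.

(** * Free families *)

Section FreeFamilies.
Variables (F : fieldType) (V : vectType F).

Definition independent d (P : 'I_d -> V) := free (mktuple P).

Lemma independentP d (P : 'I_d -> V) :
  reflect (forall c, \sum_i c i *: P i = 0 -> forall i, c i = 0)
          (independent P).
Proof.
have E c : \sum_(i < d) c i *: (mktuple P)`_i = \sum_i c i *: P i.
  by apply: eq_bigr => i _; rewrite nth_mktuple.
by apply: (equivP (freeP (X := mktuple P))); split=> h c; move: (h c); rewrite E.
Qed.

Lemma independent_neq0 d (P : 'I_d -> V) i : independent P -> P i != 0.
Proof.
move=> /independentP hP; apply/eqP => Pi0.
suff /hP/(_ i)/eqP : \sum_j (j == i)%:R *: P j = 0 by rewrite eqxx oner_eq0.
 rewrite (bigD1 i) //= Pi0 scaler0 add0r big1 // => j /negPf->.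
exact: scale0r.
Qed.

Lemma independent_scale d (P Q : 'I_d -> V) :
  independent P -> (forall i, exists2 a, a != 0 & Q i = a *: P i) ->
  independent Q.
Proof.
move=> /independentP hP /fin_all_exists2[a a0 QE]; apply/independentP => c.
under eq_bigr do rewrite QE scalerA.
by move=> /hP h i; apply/eqP; have /eqP := h i; rewrite mulf_eq0 (negPf (a0 i)) orbF.
Qed.

End FreeFamilies.

Lemma independent_inj (F : fieldType) (V W : vectType F)
  (f : {linear V -> W}) d (P : 'I_d -> V) :
  (forall v, f v = 0 -> v = 0) -> independent P -> independent (fun i => f (P i)).
Proof.
move=> finj /independentP hP; apply/independentP => c.
under eq_bigr do rewrite -linearZ; rewrite -linear_sum => /finj; exact: hP.
Qed.

(** * Vector-valued binary forms *)

Section BinaryForms.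
Variables (F : fieldType) (V : vectType F).
Implicit Types (v : F * F -> V) (y : F * F).

(** The coefficients follow the convention of [moment_curve], so that a form with
    free coefficients parametrizes a normal rational curve as it stands. *)
Definition binary_form d v := exists e : d.+1.-tuple V,
  forall y, v y = \sum_(i < d.+1) (y.1 ^+ (d - i) * y.2 ^+ i) *: e`_i.

Lemma binary_form_const w : binary_form 0 (fun=> w).
Proof.
by exists [tuple w] => y; rewrite big_ord_recl big_ord0 addr0 !expr0 mulr1 scale1r.
Qed.

Lemma eq_binary_form d u v : (forall y, u y = v y) -> binary_form d u ->
  binary_form d v.
Proof. by move=> uv [e ue]; exists e => y; rewrite -uv. Qed.

Lemma binary_formD d u v : binary_form d u -> binary_form d v ->
  binary_form d (fun y => u y + v y).
Proof.
move=> [e ue] [f vf]; exists (mktuple (fun i : 'I_d.+1 => e`_i + f`_i)) => y.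
rewrite ue vf -big_split; apply: eq_bigr => i _.
by rewrite nth_mktuple scalerDr.
Qed.

Lemma binary_formZ d k v : binary_form d v -> binary_form d (fun y => k *: v y).
Proof.
move=> [e ve]; exists (mktuple (fun i : 'I_d.+1 => k *: e`_i)) => y.
rewrite ve scaler_sumr; apply: eq_bigr => i _.
by rewrite nth_mktuple !scalerA mulrC.
Qed.

Lemma binary_form0 d : binary_form d (fun=> 0).
Proof.
exists (mktuple (fun i : 'I_d.+1 => 0)) => y.
by rewrite big1 // => i _; rewrite nth_mktuple scaler0.
Qed.

Lemma binary_form_sum d I (r : seq I) (v : I -> F * F -> V) :
  (forall i, binary_form d (v i)) ->
  binary_form d (fun y => \sum_(i <- r) v i y).
Proof.
move=> hv; elim: r => [|i r IHr].
  by apply: eq_binary_form (binary_form0 d) => y; rewrite big_nil.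
by apply: eq_binary_form (binary_formD (hv i) IHr) => y; rewrite big_cons.
Qed.

Lemma binary_form_mul_fst d v : binary_form d v ->
  binary_form d.+1 (fun y => y.1 *: v y).
Proof.
move=> [e ve]; exists (mktuple (fun i : 'I_d.+2 => e`_i)) => y.
rewrite ve [RHS]big_ord_recr nth_mktuple nth_default ?size_tuple //= scaler0 addr0.
rewrite scaler_sumr; apply: eq_bigr => i _.
rewrite (nth_mktuple _ _ (widen_ord (leqnSn _) i)) scalerA mulrA.
by rewrite -exprS -subSn // -ltnS.
Qed.

Lemma binary_form_mul_snd d v : binary_form d v ->
  binary_form d.+1 (fun y => y.2 *: v y).
Proof.
move=> [e ve]; exists [tuple of 0 :: e] => y.
rewrite ve [RHS]big_ord_recl /= scaler0 add0r scaler_sumr.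
by apply: eq_bigr => i _; rewrite /= scalerA mulrCA -exprS /bump /= add1n subSS.
Qed.

Lemma binary_form_mul_det d v b : binary_form d v ->
  binary_form d.+1 (fun y => det2 y b *: v y).
Proof.
move=> hv; have := binary_formD
  (binary_formZ b.2 (binary_form_mul_fst hv))
  (binary_formZ (- b.1) (binary_form_mul_snd hv)).
apply: eq_binary_form => y; rewrite !scalerA -scalerDl.
by congr (_ *: _); rewrite /det2; ring.
Qed.

Lemma binary_form_prod_det I (r : seq I) (Y : I -> F * F) w :
  binary_form (size r) (fun y => (\prod_(i <- r) det2 y (Y i)) *: w).
Proof.
elim: r => [|i r IHr] /=.
  by apply: eq_binary_form (binary_form_const w) => y; rewrite big_nil scale1r.
apply: eq_binary_form (binary_form_mul_det (Y i) IHr) => y.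
by rewrite big_cons scalerA.
Qed.

Lemma binary_form_homog d v k y : binary_form d v ->
  v (k * y.1, k * y.2) = k ^+ d *: v y.
Proof.
move=> [e ve]; rewrite !ve scaler_sumr; apply: eq_bigr => i _ /=.
rewrite scalerA !exprMn mulrACA -exprD subnK //; last by rewrite -ltnS.
Qed.

(** The extreme coefficients are powers of the two coordinates, and for [d = 0]
    the only coefficient is 1. *)
Lemma moment_neq0 d (e : d.+1.-tuple V) y : free e -> y != (0, 0) ->
  \sum_(i < d.+1) (y.1 ^+ (d - i) * y.2 ^+ i) *: e`_i != 0.
Proof.
move=> /freeP he; case: y => a b y0; apply/eqP => /he h.
move: (h ord0) (h ord_max) y0; rewrite /= subn0 subnn !expr0 mulr1 mul1r.
case: d {e he h} => [/eqP|d]; first by rewrite oner_eq0.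
by move=> /eqP + /eqP; rewrite !expf_eq0 /= => /eqP-> /eqP->; rewrite eqxx.
Qed.

(** The coefficients of a form span its values, so [d.+1] free values force the
    [d.+1] coefficients to be free. *)
Lemma binary_form_basis d v (K : 'I_d.+1 -> F * F) :
  binary_form d v -> independent (v \o K) ->
  exists2 e : d.+1.-tuple V, basis_of <<mktuple (v \o K)>> e &
    forall y, v y = \sum_(i < d.+1) (y.1 ^+ (d - i) * y.2 ^+ i) *: e`_i.
Proof.
move=> [e ve] fK; exists e => //.
rewrite basisEdim size_tuple (eqnP fK) size_tuple leqnn andbT.
apply/span_subvP => _ /mapP[k _ ->] /=; rewrite ve.
by apply: memv_suml => i _; rewrite memvZ // memv_span // mem_nth // size_tuple.
Qed.

(** The values at the [K k] already span the space of coefficients, hence so do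
    the points of the curve. *)
Lemma binary_form_nrc d v (K : 'I_d.+1 -> F * F) :
  binary_form d v -> (forall k, K k != (0, 0)) -> independent (v \o K) ->
  normal_rational_curve d (parametrized v).
Proof.
move=> hv K0 fK; have [e be ve] := binary_form_basis hv fK.
have v0 y : y != (0, 0) -> v y != 0.
  by move=> y0; rewrite ve moment_neq0 // (basis_free be).
exists <<mktuple (v \o K)>>%VS, e; split=> //; last first.
  by rewrite /moment_curve; congr parametrized; apply/funext.
move=> U; split=> [sub|leU].
  apply/span_subvP => _ /mapP[k _ ->] /=; rewrite memvE.
  by have [|_] := sub <[v (K k)]>%VS; first by exists (K k) => //=; exact: K0.
move=> _ [y /= y0 <-]; split; first by rewrite dim_vline v0.
rewrite -memvE; apply: (subvP leU); rewrite -(span_basis be) ve.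
by apply: memv_suml => i _; rewrite memvZ // memv_span // mem_nth // size_tuple.
Qed.

(** Homogeneous Lagrange interpolation, without the denominators: these only
    rescale the interpolated vectors, and points do not see them. *)
Definition lagrange d (Y : 'I_d.+1 -> F * F) (P : 'I_d.+1 -> V) y :=
  \sum_i (\prod_(j | j != i) det2 y (Y j)) *: P i.

Lemma binary_form_lagrange d (Y : 'I_d.+1 -> F * F) (P : 'I_d.+1 -> V) :
  binary_form d (lagrange Y P).
Proof.
apply: binary_form_sum => i.
have := binary_form_prod_det (enum (predC1 i)) Y (P i).
rewrite -cardE cardC1 card_ord /=; apply: eq_binary_form => y.
by rewrite big_enum.
Qed.

Lemma lagrangeE d (Y : 'I_d.+1 -> F * F) (P : 'I_d.+1 -> V) k :
  lagrange Y P (Y k) = (\prod_(j | j != k) det2 (Y k) (Y j)) *: P k.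
Proof.
rewrite /lagrange (bigD1 k) //= [X in _ + X]big1 ?addr0 // => i ik.
by rewrite (bigD1 k) 1?eq_sym //= det2_self mul0r scale0r.
Qed.

Lemma lagrange_interp d (Y : 'I_d.+1 -> F * F) (P : 'I_d.+1 -> V) :
  (forall i j, i != j -> det2 (Y i) (Y j) != 0) ->
  forall k, exists2 a, a != 0 & lagrange Y P (Y k) = a *: P k.
Proof.
move=> hY k; exists (\prod_(j | j != k) det2 (Y k) (Y j)); last exact: lagrangeE.
by apply/prodf_neq0 => j jk; apply: hY; rewrite eq_sym.
Qed.

End BinaryForms.

Lemma binary_form_linear (F : fieldType) (V W : vectType F)
  (f : {linear V -> W}) d v :
  binary_form d v -> binary_form d (fun y => f (v y)).
Proof.
move=> [e ve]; exists (mktuple (fun i : 'I_d.+1 => f e`_i)) => y.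
rewrite ve linear_sum; apply: eq_bigr => i _.
by rewrite nth_mktuple linearZ.
Qed.

(** * Points and rank one matrices *)

Section Points.
Variables (F : fieldType) (V : vectType F).

Lemma vlineZ k (v : V) : k != 0 -> <[k *: v]>%VS = <[v]>%VS.
Proof.
move=> k0; apply: subv_anti; rewrite -!memvE memvZ ?memv_line //=.
by apply/vlineP; exists k^-1; rewrite scalerA mulVf // scale1r.
Qed.

Lemma point_gen (p : {vspace V}) : \dim p = 1%N ->
  exists2 v, v != 0 & p = <[v]>%VS.
Proof.
move=> p1; exists (vpick p); first by rewrite vpick0 -dimv_eq0 p1.
apply/eqP; rewrite eq_sym eqEdim -memvE memv_pick dim_vline vpick0 -dimv_eq0.
by rewrite p1.
Qed.

Lemma eq_parametrized (u v : F * F -> V) :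
  (forall y, y != (0, 0) -> exists2 a, a != 0 & u y = a *: v y) ->
  parametrized u = parametrized v.
Proof.
move=> uv; apply/seteqP; split=> _ [y /= y0 <-]; exists y => //;
  by have [a a0 ->] := uv y y0; rewrite vlineZ.
Qed.

Lemma independent_nonprop d (P : 'I_d -> V) i j k :
  independent P -> i != j -> P i != k *: P j.
Proof.
move=> /independentP hP ij; apply/eqP => Pij.
suff /hP/(_ i)/eqP : \sum_l ((l == i)%:R - k * (l == j)%:R) *: P l = 0.
  by rewrite eqxx (negPf ij) mulr0 subr0 oner_eq0.
rewrite (bigD1 i) //= (bigD1 j) 1?eq_sym //= big1 ?addr0.
  rewrite !eqxx [j == i]eq_sym (negPf ij) Pij scalerA -scalerDl.
  by rewrite mulr0 mulr1 subr0 mul1r add0r subrr scale0r.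
by move=> l /andP[/negPf-> /negPf->]; rewrite mulr0 subrr scale0r.
Qed.

End Points.

Lemma rank1_row_prop (F : fieldType) m n (a c : 'cV[F]_m) (b x : 'rV[F]_n) :
  a != 0 -> a *m b = c *m x -> exists k, b = k *: x.
Proof.
move=> a0 abcx; have /cV0Pn[i ai] := a0; exists ((a i 0)^-1 * c i 0).
apply/rowP => j; have /matrixP/(_ i j) := abcx.
by rewrite !mxE !big_ord1 -mulrA => <-; rewrite mulrA mulVf // mul1r.
Qed.

Lemma rank1_eq0 (F : fieldType) m n (a : 'cV[F]_m) (b : 'rV[F]_n) :
  a != 0 -> a *m b = 0 -> b = 0.
Proof.
move=> a0 ab; have [|k ->] := @rank1_row_prop _ _ _ a 0 b 0 a0; last exact: scaler0.
by rewrite ab mul0mx.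
Qed.

Section PairsAsColumns.
Variable F : fieldType.
Implicit Types y a b : F * F.

Definition col_of y : 'cV[F]_2 := \col_i (if i == 0 then y.1 else y.2).

Lemma col_ofE (z : 'cV[F]_2) : z = col_of (z 0 0, z 1 0).
Proof.
apply/colP => i; rewrite mxE; case: eqVneq => [->//|i0].
by rewrite (_ : i = 1) //; apply/val_inj; case: i i0 => [[|[]]].
Qed.

Lemma col_of_eq0 y : (col_of y == 0) = (y == (0, 0)).
Proof.
case: y => a b; apply/eqP/eqP => [/colP h|[-> ->]].
  by have := h 0; have := h 1; rewrite !mxE /= => -> ->.
by apply/colP => i; rewrite !mxE if_same.
Qed.

Lemma col_ofZ k y : col_of (k * y.1, k * y.2) = k *: col_of y.
Proof. by apply/colP => i; rewrite !mxE; case: ifP. Qed.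

(** The Pluecker relation between the three directions [a], [b] and [y]. *)
Lemma col_of_plucker a b y :
  det2 a b *: col_of y = det2 y b *: col_of a - det2 y a *: col_of b.
Proof. by apply/colP => i; rewrite !mxE /det2; case: ifP => _; ring. Qed.

Lemma col_of_split n y (x : 'rV[F]_n) :
  col_of y *m x = y.1 *: (col_of (1, 0) *m x) + y.2 *: (col_of (0, 1) *m x).
Proof.
rewrite !scalemxAl -mulmxDl; congr (_ *m _); apply/colP => i.
by rewrite !mxE; case: ifP => _; rewrite /= !(mulr0, mulr1, addr0, add0r).
Qed.

(** The row representing the linear form [fun a => det2 a y], whose kernel is the
    line of [col_of y]. *)
Definition det_row y : 'rV[F]_2 := \row_i (if i == 0 then y.2 else - y.1).

Lemma det_row_col n y a (x : 'rV[F]_n) :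
  det_row y *m (col_of a *m x) = det2 a y *: x.
Proof.
rewrite mulmxA; apply/rowP => j; rewrite !mxE big_ord1 !mxE.
by rewrite big_ord_recl big_ord1 !mxE /= /det2; congr (_ * _); ring.
Qed.

Lemma col_det_row_decomp n y w (M : 'M[F]_(2, n)) :
  det2 y w *: M = col_of y *m (det_row w *m M) - col_of w *m (det_row y *m M).
Proof.
rewrite !mulmxA -mulmxBl -mul_scalar_mx; congr (_ *m _).
apply/matrixP => i j; rewrite !mxE !big_ord1 !mxE /det2.
by case: i => [[|[]]] // ?; case: j => [[|[]]] // ?; rewrite /= ?(mulr1n, mulr0n); ring.
Qed.

Lemma det_row_ker n y (M : 'M[F]_(2, n)) : y != (0, 0) -> det_row y *m M = 0 ->
  exists x, M = col_of y *m x.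
Proof.
move=> y0 yM; have [w _] := det2_exists y0.
rewrite det2C oppr_eq0 => yw; exists ((det2 y w)^-1 *: (det_row w *m M)).
apply: (scalerI yw); rewrite -scalemxAr scalerA mulfV // scale1r.
by rewrite col_det_row_decomp yM mulmx0 subr0.
Qed.

End PairsAsColumns.

Lemma binary_form_col_of (F : fieldType) n d (u : F * F -> 'rV[F]_n) :
  binary_form d u -> binary_form d.+1 (fun y => col_of y *m u y).
Proof.
move=> hu; apply: eq_binary_form (fun y => esym (col_of_split y (u y))) _.
apply: binary_formD; [apply: binary_form_mul_fst | apply: binary_form_mul_snd].
  exact: binary_form_linear.
exact: binary_form_linear.
Qed.

(** * The points of the section *)

Definition row_parametrization (F : fieldType) n (S : {vspace 'M[F]_(2, n)})
    (u : F * F -> 'rV[F]_n) :=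
  forall y, y != (0, 0) -> u y != 0 /\ col_of y *m u y \in S.

Section RegulusSection.
Variables (F : fieldType) (n t : nat) (S : {vspace 'M[F]_(2, n)}).
Hypothesis dimS : \dim S = t.+1.
Hypothesis onept : forall W : {vspace 'M[F]_(2, n)}, segreI F 2 n W ->
  exists p : {vspace 'M[F]_(2, n)}, pts S `&` pts W = [set p].

Local Notation regulus_space z :=
  (limg (linfun (mulmx z : 'rV[F]_n -> 'M[F]_(2, n)))).

Lemma regulus_meet y : y != (0, 0) ->
  exists2 x : 'rV[F]_n, x != 0 & col_of y *m x \in S.
Proof.
rewrite -col_of_eq0 => y0.
have [|p pE] := @onept (regulus_space (col_of y)).
  by exists (col_of y).
have [[p1 pS] [_ pW]] : (pts S `&` pts (regulus_space (col_of y))) p.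
  by rewrite pE.
have [v v0 pv] := point_gen p1; move: pS pW; rewrite pv -!memvE => vS.
move=> /memv_imgP[x _]; rewrite lfunE /= => vE; exists x; last by rewrite -vE.
by apply: contraNneq v0 => x0; rewrite vE x0 mulmx0.
Qed.

Lemma regulus_meet_uniq y (x x' : 'rV[F]_n) : y != (0, 0) -> x != 0 ->
  col_of y *m x \in S -> col_of y *m x' \in S -> exists k, x' = k *: x.
Proof.
rewrite -col_of_eq0 => y0 x0 xS x'S.
have [->|x'0] := eqVneq x' 0; first by exists 0; rewrite scale0r.
have [|p pE] := @onept (regulus_space (col_of y)).
  by exists (col_of y).
have inp (r : 'rV[F]_n) : r != 0 -> col_of y *m r \in S ->
    <[col_of y *m r]>%VS = p.
  move=> r0 rS; suff: [set p] <[col_of y *m r]>%VS by [].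
  rewrite -pE; split; split; rewrite ?dim_vline -?memvE //.
  - by rewrite (contra_neq (rank1_eq0 y0)).
  - by rewrite (contra_neq (rank1_eq0 y0)).
  - by apply/memv_imgP; exists r; rewrite ?memvf // lfunE.
have /vlineP[k] : col_of y *m x' \in <[col_of y *m x]>%VS.
  by rewrite (inp x) // -(inp x') // memv_line.
by rewrite scalemxAl => /(rank1_row_prop y0)[l ->]; exists l.
Qed.

Section Parametrization.
Variable u : F * F -> 'rV[F]_n.
Hypothesis hu : row_parametrization S u.

Lemma param_neq0 y : y != (0, 0) -> col_of y *m u y != 0.
Proof.
move=> y0; have [u0 _] := hu y0; apply: contra_neq u0.
by apply: rank1_eq0; rewrite col_of_eq0.
Qed.

Lemma param_section :
  pts S `&` segre F 2 n = parametrized (fun y => col_of y *m u y).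
Proof.
apply/seteqP; split=> [q [[q1 +] [x [z [_ x0 z0 qE]]]]|_ [y /= y0 <-]].
  rewrite qE -memvE (col_ofE z); set y := (_, _) => xS.
  have y0 : y != (0, 0) by rewrite -col_of_eq0 -col_ofE.
  have [u0 uS] := hu y0; exists y => //.
  have [k xE] := regulus_meet_uniq y0 u0 uS xS.
  rewrite xE -scalemxAr vlineZ //; apply: contra_neq x0 => k0.
  by rewrite xE k0 scale0r.
have [u0 uS] := hu y0; split.
  by split; rewrite ?dim_vline ?param_neq0 -?memvE.
by exists (u y), (col_of y); rewrite memvf col_of_eq0.
Qed.

Lemma param_transversal_section (z : 'cV[F]_2) : z != 0 ->
  transversal_section (pts S `&` segre F 2 n)
    (regulus_space z) =
  parametrized (fun y => z *m u y).
Proof.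
move=> z0; rewrite param_section; apply/seteqP; split=> [q|_ [y /= y0 <-]].
  move=> [l [[x /= x0 lE] [p [[p1 pl] [y /= y0 pE]]]] [[q1 qXi] [_ ql]]].
  have [v v0 qE] := point_gen q1.
  move: pl qXi ql; rewrite -lE -pE qE -!memvE.
  move=> /memv_imgP[c _]; rewrite lfunE /= => yc.
  move=> /memv_imgP[r _]; rewrite lfunE /= => vr.
  move=> /memv_imgP[d _]; rewrite lfunE /= => vd.
  have [u0 _] := hu y0; have yn0 : col_of y != 0 by rewrite col_of_eq0.
  have [k uE] := rank1_row_prop yn0 yc.
  have [m rE] : exists m, r = m *: x.
    by apply: (rank1_row_prop z0 (c := d)); rewrite -vr.
  have k0 : k != 0 by apply: contra_neq u0 => k0; rewrite uE k0 scale0r.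
  have m0 : m != 0.
    by apply: contra_neq v0 => m0; rewrite vr rE m0 scale0r mulmx0.
  by exists y; rewrite // uE vr rE -!scalemxAr !vlineZ.
have [u0 uS] := hu y0.
exists (limg (linfun (mulmxr (u y) : 'cV[F]_2 -> 'M[F]_(2, n)))).
  split; first by exists (u y).
  exists <[col_of y *m u y]>%VS; split; last by exists y.
  split; first by rewrite dim_vline param_neq0.
  by rewrite -memvE; apply/memv_imgP; exists (col_of y); rewrite ?memvf // lfunE.
have zu0 : z *m u y != 0 by apply: contra_neq u0; exact: rank1_eq0.
split; split; rewrite ?dim_vline ?zu0 // -memvE.
  by apply/memv_imgP; exists (u y); rewrite ?memvf // lfunE.
by apply/memv_imgP; exists z; rewrite ?memvf // lfunE.
Qed.

End Parametrization.

Hypothesis spanS : spans (pts S `&` segre F 2 n) S.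

(** Vectors spanning points of Phi are added one by one: as long as their span is
    smaller than [S], it misses some point of Phi. *)
Lemma section_frame : exists (Y : 'I_t.+1 -> F * F) (X : 'I_t.+1 -> 'rV[F]_n),
  [/\ forall i, Y i != (0, 0), forall i, col_of (Y i) *m X i \in S &
      independent (fun i => col_of (Y i) *m X i)].
Proof.
pose f (a : (F * F) * 'rV[F]_n) := col_of a.1 *m a.2.
have [s [ss sP fs]] : exists s, [/\ size s = t.+1,
    (forall a, a \in s -> a.1 != (0, 0) /\ f a \in S) & free (map f s)].
  suff H k : (k <= t.+1)%N -> exists s, [/\ size s = k,
      (forall a, a \in s -> a.1 != (0, 0) /\ f a \in S) & free (map f s)].
    exact: H.
  elim: k => [|k IHk] kt; first by exists [::]; split=> //=; exact: nil_free.
  have [s [ss sP fs]] := IHk (ltnW kt).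
  have [v vS vs] : exists2 v : (F * F) * 'rV[F]_n,
      v.1 != (0, 0) /\ f v \in S & f v \notin <<map f s>>%VS.
    apply: contrapT => hno.
    have /dimvS : (S <= <<map f s>>)%VS.
      apply/spanS => p [[p1 pS] [x [z [_ _ z0 pE]]]].
      split=> //; move: pS; rewrite pE -!memvE (col_ofE z); set y := (_, _) => xS.
      apply/negPn/negP => xn; apply: hno; exists (y, x) => //; split=> //.
      by rewrite -col_of_eq0 -col_ofE.
    by rewrite dimS (eqnP fs) size_map ss leqNgt kt.
  exists (v :: s); split; [by rewrite /= ss | | by rewrite /= free_cons vs].
  by move=> a; rewrite inE => /predU1P[->|/sP].
pose a i := nth ((0, 0), 0) s i.
have a_in (i : 'I_t.+1) : a i \in s by rewrite mem_nth // ss.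
exists (fun i => (a i).1), (fun i => (a i).2).
split=> [i|i|]; [by case: (sP _ (a_in i)) | by case: (sP _ (a_in i)) |].
rewrite /independent (_ : tval _ = map f s) //.
apply: (@eq_from_nth _ 0) => [|i]; rewrite size_tuple ?size_map ?ss // => it.
by rewrite (nth_mktuple _ _ (Ordinal it)) (nth_map ((0, 0), 0)) ?ss.
Qed.

Section Frame.
Variables (Y : 'I_t.+1 -> F * F) (X : 'I_t.+1 -> 'rV[F]_n).
Hypothesis Y_neq0 : forall i, Y i != (0, 0).
Hypothesis frame_in : forall i, col_of (Y i) *m X i \in S.
Hypothesis frame_free : independent (fun i => col_of (Y i) *m X i).

Lemma frame_row_neq0 i : X i != 0.
Proof.
by apply: contraNneq (independent_neq0 i frame_free) => ->; rewrite mulmx0.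
Qed.

(** Two frame vectors with proportional columns would lie in the same regulus
    element, which meets [S] in a single point. *)
Lemma frame_directions i j : i != j -> det2 (Y i) (Y j) != 0.
Proof.
move=> ij; apply/eqP => /(det2_eq0P (Y_neq0 j))[k Yik].
have k0 : k != 0.
  by apply: contraNneq (Y_neq0 i) => k0; rewrite Yik k0 !mul0r.
have := frame_in i; rewrite Yik col_ofZ -scalemxAl => /(memvZ k^-1).
rewrite scalerA mulVf // scale1r.
move=> /(regulus_meet_uniq (Y_neq0 j) (frame_row_neq0 j) (frame_in j))[l Xil].
have /eqP[] := independent_nonprop (k * l) frame_free ij.
by rewrite Yik col_ofZ Xil -scalemxAl -scalemxAr scalerA.
Qed.

Lemma frame_expand M : M \in S ->
  exists c, M = \sum_i c i *: (col_of (Y i) *m X i).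
Proof.
move=> MS; pose e := mktuple (fun i => col_of (Y i) *m X i).
have be : basis_of S e.
  rewrite basisEfree (frame_free : free e) size_tuple dimS leqnn andbT.
  by apply/span_subvP => _ /mapP[i _ ->]; exact: frame_in.
exists (fun i => coord e i M); rewrite {1}(coord_basis be MS).
by apply: eq_bigr => i _; rewrite nth_mktuple.
Qed.

(** If the relation misses [X k], divide its coefficients by [det2 (Y i) (Y k)]:
    the resulting combination of the frame lies in the regulus element of [Y k],
    so it is a multiple of the frame vector of index [k], against freeness. *)
Lemma frame_relation c k : \sum_i c i *: X i = 0 -> c k = 0 ->
  forall i, c i = 0.
Proof.
move=> cX ck; pose d i := c i / det2 (Y i) (Y k).
have dS : \sum_i d i *: (col_of (Y i) *m X i) \in S.
  by apply: memv_suml => i _; rewrite memvZ.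
have [|x xE] := @det_row_ker _ _ (Y k)
    (\sum_i d i *: (col_of (Y i) *m X i)) (Y_neq0 k).
  rewrite -[RHS]cX linear_sum; apply: eq_bigr => i _.
  rewrite linearZ /= det_row_col scalerA; have [->|ik] := eqVneq i k.
    by rewrite det2_self mulr0 ck.
  by rewrite divfK // frame_directions.
rewrite xE in dS; have [l xl] :=
  regulus_meet_uniq (Y_neq0 k) (frame_row_neq0 k) (frame_in k) dS.
have {}xl : \sum_i (d i - l * (i == k)%:R) *: (col_of (Y i) *m X i) = 0.
  under eq_bigr do rewrite scalerBl; rewrite sumrB xE xl (bigD1 k) //= eqxx mulr1.
  rewrite big1 ?addr0 -?scalemxAr ?subrr // => i /negPf->.
  by rewrite mulr0 scale0r.
move=> i; have [->//|ik] := eqVneq i k.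
move/independentP/(_ _ xl i): frame_free; rewrite (negPf ik) mulr0 subr0 => /eqP.
by rewrite mulf_eq0 invr_eq0 (negPf (frame_directions ik)) orbF => /eqP.
Qed.

(** Contracting an expansion of the point of [S] in direction [y] with [det_row y]
    kills the left side, and the factors [det2 (Y i) y] kill no term. *)
Lemma missed_direction_dependent y : y != (0, 0) ->
  (forall i, det2 y (Y i) != 0) -> ~~ independent X.
Proof.
move=> y0 yY; have [x x0 xS] := regulus_meet y0; have [c xE] := frame_expand xS.
apply/negP => /independentP indX.
have c0 : forall i, c i * det2 (Y i) y = 0.
  apply: indX; transitivity (det_row y *m (col_of y *m x)).
    rewrite xE linear_sum; apply: eq_bigr => i _.
    by rewrite linearZ /= det_row_col scalerA.
  by rewrite det_row_col det2_self scale0r.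
case/eqP: x0; apply: (@rank1_eq0 _ _ _ (col_of y)); first by rewrite col_of_eq0.
rewrite xE big1 // => i _; have /eqP := c0 i.
by rewrite mulf_eq0 det2C oppr_eq0 (negPf (yY i)) orbF => /eqP->; rewrite scale0r.
Qed.

Lemma dependent_relation : ~~ independent X ->
  exists2 c, (forall i, c i != 0) & \sum_i c i *: X i = 0.
Proof.
move=> /independentP dX; apply: contrapT => hno; apply: dX => c cX i.
apply: contrapT => ci; apply: hno; exists c => // k.
by apply/eqP => ck; apply: ci; exact: frame_relation cX ck i.
Qed.

(** As [y] is proportional to some [Y i], homogeneity reduces the claim to the
    interpolated value at [Y i]. *)
Lemma covered_param : (forall y, y != (0, 0) -> exists i, det2 y (Y i) = 0) ->
  row_parametrization S (lagrange Y X).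
Proof.
move=> cov y y0; have [i /(det2_eq0P (Y_neq0 i))[k yE]] := cov y y0.
have k0 : k != 0 by apply: contraNneq y0 => k0; rewrite yE k0 !mul0r.
have [a a0 aE] := lagrange_interp X frame_directions i.
rewrite yE (binary_form_homog _ _ (binary_form_lagrange Y X)) aE; split.
  by rewrite !scaler_eq0 expf_eq0 (negPf k0) andbF (negPf a0) frame_row_neq0.
by rewrite col_ofZ -scalemxAl -!scalemxAr !memvZ.
Qed.

(** The form [col_of y *m lagrange Y X y] has degree [t.+1]; at every point it is
    proportional to the form of degree [t] that interpolates the frame itself. *)
Lemma covered_section_nrc :
  (forall y, y != (0, 0) -> exists i, det2 y (Y i) = 0) ->
  normal_rational_curve t (pts S `&` segre F 2 n).
Proof.
move=> cov; rewrite (param_section (covered_param cov)).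
pose P i := col_of (Y i) *m X i.
suff -> : parametrized (fun y => col_of y *m lagrange Y X y) =
    parametrized (lagrange Y P).
  apply: binary_form_nrc (binary_form_lagrange Y P) Y_neq0 _.
  apply: independent_scale frame_free _ => i.
  exact: lagrange_interp frame_directions i.
apply: eq_parametrized => y y0.
have [i /(det2_eq0P (Y_neq0 i))[k yE]] := cov y y0; exists k.
  by apply: contraNneq y0 => k0; rewrite yE k0 !mul0r.
rewrite yE (binary_form_homog _ _ (binary_form_lagrange Y X)).
rewrite (binary_form_homog _ _ (binary_form_lagrange Y P)) !lagrangeE.
by rewrite col_ofZ -scalemxAl -!scalemxAr.
Qed.

Lemma param_section_nrc u : binary_form t (fun y => col_of y *m u y) ->
  row_parametrization S u -> normal_rational_curve t (pts S `&` segre F 2 n).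
Proof.
move=> hv hu; rewrite (param_section hu).
apply: binary_form_nrc hv Y_neq0 _; apply: independent_scale frame_free _ => i /=.
have [u0 uS] := hu _ (Y_neq0 i).
have [k uE] := regulus_meet_uniq (Y_neq0 i) (frame_row_neq0 i) (frame_in i) uS.
exists k; last by rewrite uE scalemxAr.
by apply: contra_neq u0 => k0; rewrite uE k0 scale0r.
Qed.

End Frame.
End RegulusSection.

(** * Dependent rows *)

(** Eliminate [w ord0] by the relation. The coefficient of each remaining [w i]
    is then a common product times
    [det2 y (Y ord0) *: col_of (Y i) - det2 y (Y i) *: col_of (Y ord0)], which is
    a multiple of [col_of y] by the Pluecker relation. *)
Lemma lagrange_factor (F : fieldType) n s (Y : 'I_s.+2 -> F * F)
    (w : 'I_s.+2 -> 'rV[F]_n) y : \sum_i w i = 0 ->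
  col_of y *m lagrange (fun i => Y (lift ord0 i))
    (fun i => det2 (Y (lift ord0 i)) (Y ord0) *: w (lift ord0 i)) y =
  lagrange Y (fun i => col_of (Y i) *m w i) y.
Proof.
move=> w0; rewrite [RHS]/lagrange big_ord_recl.
have {w0} -> : w ord0 = - \sum_i w (lift ord0 i).
  by apply/eqP; move/eqP: w0; rewrite big_ord_recl addr_eq0.
rewrite mulmxN [X in _ *: - X]mulmx_sumr scalerN scaler_sumr -sumrN -big_split /=.
rewrite [LHS]mulmx_sumr; apply: eq_bigr => i _.
have -> : \prod_(j | j != lift ord0 i) det2 y (Y j) =
    det2 y (Y ord0) * \prod_(j | j != i) det2 y (Y (lift ord0 j)).
  rewrite [LHS]big_mkcond big_ord_recl /=; congr (_ * _).
  rewrite [RHS]big_mkcond; apply: eq_bigr => j _.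
  by rewrite (inj_eq lift_inj).
have -> : \prod_(j | j != ord0) det2 y (Y j) =
    det2 y (Y (lift ord0 i)) * \prod_(j | j != i) det2 y (Y (lift ord0 j)).
  rewrite [LHS]big_mkcond big_ord_recl /= mul1r (bigD1 i) //=.
set p := \prod_(j | j != i) _; set x := w _.
rewrite -scalemxAr -scalemxAr scalemxAl col_of_plucker mulmxBl -!scalemxAl.
by rewrite scalerBr !scalerA addrC ![p * _]mulrC.
Qed.

(** All coefficients of the relation are nonzero, so they can be absorbed in the
    rows. The interpolated rows at the directions other than [Y ord0] are free,
    because a relation between them would miss [X ord0]. *)
Lemma dependent_param (F : fieldType) n s (S : {vspace 'M[F]_(2, n)})
    (onept : forall W : {vspace 'M[F]_(2, n)}, segreI F 2 n W ->
       exists p : {vspace 'M[F]_(2, n)}, pts S `&` pts W = [set p])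
    (Y : 'I_s.+2 -> F * F) (X : 'I_s.+2 -> 'rV[F]_n)
    (Y_neq0 : forall i, Y i != (0, 0))
    (frame_in : forall i, col_of (Y i) *m X i \in S)
    (frame_free : independent (fun i => col_of (Y i) *m X i)) :
  ~~ independent X -> exists (u : F * F -> 'rV[F]_n) (K : 'I_s.+1 -> F * F),
    [/\ binary_form s u, forall k, K k != (0, 0), independent (u \o K) &
        row_parametrization S u].
Proof.
move=> /(dependent_relation onept Y_neq0 frame_in frame_free)[c c0 cX].
have hY := frame_directions onept Y_neq0 frame_in frame_free.
pose K (i : 'I_s.+1) := Y (lift ord0 i).
have hK i j : i != j -> det2 (K i) (K j) != 0.
  by move=> ij; apply: hY; rewrite (inj_eq lift_inj).
pose w i := c i *: X i.
pose Q i := det2 (K i) (Y ord0) *: w (lift ord0 i).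
have hu : binary_form s (lagrange K Q) := binary_form_lagrange K Q.
have uK : independent (lagrange K Q \o K).
  have : independent (fun i => X (lift ord0 i)).
    apply/independentP => d dX i.
    (* extend the relation by the coefficient 0 at [ord0] *)
    pose d' j := if unlift ord0 j is Some k then d k else 0.
    have d'X : \sum_j d' j *: X j = 0.
      rewrite big_ord_recl /d' unlift_none scale0r add0r -[RHS]dX.
      by apply: eq_bigr => j _; rewrite liftK.
    have d'0 : d' ord0 = 0 by rewrite /d' unlift_none.
    have := frame_relation onept Y_neq0 frame_in frame_free d'X d'0 (lift ord0 i).
    by rewrite /d' liftK.
  move/independent_scale; apply=> i /=.
  have [a a0 ->] := lagrange_interp Q hK i.
  exists (a * (det2 (K i) (Y ord0) * c (lift ord0 i))); last first.
    by rewrite /Q /w !scalerA.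
  by rewrite !mulf_neq0 // hY.
exists (lagrange K Q), K; split=> // [i|y y0]; first exact: Y_neq0.
have [e be ue] := binary_form_basis hu uK; split.
  by rewrite ue moment_neq0 // (basis_free be).
rewrite lagrange_factor // memv_suml // => i _.
by rewrite memvZ // -scalemxAr memvZ.
Qed.

(** * Coordinates *)

Definition std_frame (F : fieldType) : 2.-tuple 'cV[F]_2 :=
  [tuple col_of (1, 0); col_of (0, 1)].

Lemma std_frame_expand (F : fieldType) (z : 'cV[F]_2) :
  z = \sum_(i < 2) z i 0 *: (std_frame F)`_i.
Proof.
rewrite big_ord_recl big_ord1 /=.
apply/colP => i; rewrite !mxE; case: i => [[|[]]] // ?;
  rewrite /= ?(mulr0, mulr1, addr0, add0r); congr (z _ _); exact: val_inj.
Qed.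

Lemma std_frame_basis (F : fieldType) : basis_of fullv (std_frame F).
Proof.
rewrite basisEdim dimvf /dim /= muln1 leqnn andbT.
apply/subvP => z _; rewrite (std_frame_expand z).
by apply: memv_suml => i _; rewrite memvZ // memv_span // mem_nth.
Qed.

Lemma of_coords_rank1 (F : fieldType) n t (e : t.-tuple 'rV[F]_n)
    (z : 'cV[F]_2) (a : 'I_t -> F) :
  of_coords (std_frame F) e (\matrix_(i, j) (a j * z i 0)) =
  z *m \sum_(j < t) a j *: e`_j.
Proof.
rewrite {2}(std_frame_expand z) mulmx_suml; apply: eq_bigr => i _.
rewrite mulmx_sumr; apply: eq_bigr => j _.
by rewrite mxE -scalemxAr -scalemxAl scalerA mulrC.
Qed.

(** * The theorem *)

(* The hypothesis [honept] excludes t = 0, so [t.-1] below is t - 1. *)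
Theorem lemma2p1 (F : fieldType) (n t : nat) (hn : (1 < n)%N)
    (S : {vspace 'M[F]_(2, n)}) (hdim : \dim S = t.+1)
    (honept : forall W : {vspace 'M[F]_(2, n)}, segreI F 2 n W ->
       exists p : {vspace 'M[F]_(2, n)}, pts S `&` pts W = [set p])
    (Phi : set {vspace 'M[F]_(2, n)}) (hPhi : Phi = pts S `&` segre F 2 n)
    (hspan : spans Phi S) :
  [/\ `I_t #<= [set: F],
      normal_rational_curve t Phi,
      forall Xi : {vspace 'M[F]_(2, n)}, segreI F 2 n Xi ->
        ([set: F] #= `I_t ->
           normal_rational_curve t (transversal_section Phi Xi) \/
           normal_rational_curve t.-1 (transversal_section Phi Xi)) /\
        (`I_t.+1 #<= [set: F] ->
           normal_rational_curve t.-1 (transversal_section Phi Xi))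
    & forall U : {vspace 'rV[F]_n}, \dim U = t -> Phi `<=` segre_sub 2 U ->
        exists (f : 2.-tuple 'cV[F]_2) (e : t.-tuple 'rV[F]_n),
          [/\ basis_of fullv f,
              basis_of U e,
              Phi = parametrized (fun y => of_coords f e
                (\matrix_(i < 2, j < t)
                   (y.1 ^+ (t - (i + j)) * y.2 ^+ (i + j))))
            & forall Xi : {vspace 'M[F]_(2, n)}, segreI F 2 n Xi ->
                exists2 z : 'cV[F]_2, z != 0 &
                  transversal_section Phi Xi =
                    parametrized (fun y => of_coords f e
                      (\matrix_(i < 2, j < t)
                         (y.1 ^+ (t.-1 - j) * y.2 ^+ j * z i 0)))]].
Proof.
subst Phi.
have [Y [X [Y0 XS indP]]] := section_frame hdim hspan.
have hY := frame_directions honept Y0 XS indP.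
have X0 i : X i != 0 := frame_row_neq0 indP i.
have missed_dep y (y0 : y != (0, 0)) (yY : forall i, det2 y (Y i) != 0) :
  ~~ independent X := missed_direction_dependent hdim honept XS indP y0 yY.
have cov_or_dep : (forall y, y != (0, 0) -> exists i, det2 y (Y i) = 0) \/
    ~~ independent X.
  have [?|/existsNP[y /not_implyP[y0 yY]]] :=
    pselect (forall y, y != (0, 0) -> exists i, det2 y (Y i) = 0); first by left.
  right; apply: (missed_dep y) => // i.
  by apply/eqP => yYi; apply: yY; exists i.
case: t hdim hspan Y X Y0 XS indP hY X0 missed_dep cov_or_dep =>
    [|s] hdim hspan Y X Y0 XS indP hY X0 missed_dep cov_or_dep.
  (* t = 0: a second direction would make the single nonzero row dependent *)
  have [y y0 yY] := det2_exists (Y0 ord0).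
  have [|c c0] := dependent_relation honept Y0 XS indP.
    by apply: (missed_dep y) => // i; rewrite ord1.
  rewrite big_ord1 => /eqP; rewrite scaler_eq0 (negPf (c0 _)) /=.
  by rewrite (negPf (X0 _)).
have dep_param := dependent_param honept Y0 XS indP.
have dep_TS : ~~ independent X -> forall Xi, segreI F 2 n Xi ->
    normal_rational_curve s (transversal_section (pts S `&` segre F 2 n) Xi).
  move=> /dep_param[u [K [hu K0 uK uS]]] _ [z /= z0 <-].
  rewrite (param_transversal_section honept uS z0).
  apply: (binary_form_nrc (K := K)) => //; first exact: binary_form_linear.
  apply: independent_inj uK => r; exact: rank1_eq0.
split.
- exact: directions_card_le hY.
- case: cov_or_dep => [|/dep_param[u [K [hu K0 uK uS]]]].
    exact: (covered_section_nrc honept Y0 XS indP).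
  apply: (param_section_nrc honept Y0 XS indP _ uS).
  exact: binary_form_col_of.
- move=> Xi XiI; split=> [cardF|cardF]; last first.
    have [y y0 yY] := missed_direction Y0 cardF.
    exact: dep_TS (missed_dep y y0 yY) Xi XiI.
  have [indX|dX] := boolP (independent X); last by right; exact: dep_TS.
  left; case: cov_or_dep => [cov|]; last by rewrite indX.
  have uS := covered_param honept Y0 XS indP cov.
  case: XiI => z /= z0 <-; rewrite (param_transversal_section honept uS z0).
  apply: (binary_form_nrc _ Y0).
    exact: binary_form_linear (binary_form_lagrange Y X).
  apply: independent_inj; first by move=> r; exact: rank1_eq0.
  by apply: independent_scale indX _ => i; exact: lagrange_interp hY i.
move=> U dimU PhiU.
have inU y r : y != (0, 0) -> r != 0 -> col_of y *m r \in S -> r \in U.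
  rewrite -col_of_eq0 => y0 r0 rS.
  have [|x [z [xU _ _ E]]] := PhiU <[col_of y *m r]>%VS.
    split; last by exists r, (col_of y); rewrite memvf.
    by split; rewrite -?memvE // dim_vline (contra_neq (rank1_eq0 y0)).
  have /vlineP[k] : col_of y *m r \in <[z *m x]>%VS by rewrite -E memv_line.
  by rewrite scalemxAl => /(rank1_row_prop y0)[l ->]; rewrite memvZ.
have span_leU d (P : 'I_d -> 'rV[F]_n) : (forall i, P i \in U) ->
    (<<mktuple P>> <= U)%VS.
  by move=> PU; apply/span_subvP => _ /mapP[i _ ->].
have [|u [K [hu K0 uK uS]]] := dep_param.
  apply/negP => indX.
  have := dimvS (span_leU _ X (fun i => inU _ _ (Y0 i) (X0 i) (XS i))).
  by rewrite (eqnP indX) size_tuple dimU ltnn.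
have [e be ue] := binary_form_basis hu uK.
have spanK : <<mktuple (u \o K)>>%VS = U.
  apply/eqP; rewrite eqEdim (eqnP uK) size_tuple dimU leqnn andbT span_leU // => i.
  by have [? ?] := uS _ (K0 i); exact: inU (K0 i) _ _.
rewrite spanK in be.
exists (std_frame F), e; split=> //; first exact: std_frame_basis.
  rewrite (param_section honept uS); congr parametrized; apply/funext => y.
  rewrite ue -of_coords_rank1; congr of_coords; apply/matrixP => i j.
  rewrite !mxE /=; have js : (j <= s)%N by rewrite -ltnS.
  case: i => [[|[|i]]] //= _.
    by rewrite add0n subSn // exprS; ring.
  by rewrite add1n subSS exprS; ring.
move=> _ [z /= z0 <-]; exists z => //.
rewrite (param_transversal_section honept uS z0); congr parametrized.
by apply/funext => y; rewrite of_coords_rank1 ue.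
Qed.
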